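(* Let $r\ge 2$ be an integer. The following four assertions are equivalent. (1) For every finite biclique $G$ and every coloring of $E(G)$ with $r$ colors, $V(G)$ can be covered by the vertex sets of at most $2r-2$ monochromatic components. (2) For every finite biclique $G$ and every partition of $G$ into $r$ bi-equivalence graphs $G_1,\dots,G_r$, $V(G)$ can be covered by the vertex sets of at most $2r-2$ connected components of the graphs $G_1,\dots,G_r$. (3) For every finite biclique $G$ and every spanning partition of $G$ into $r$ bi-equivalence graphs $G_1,\dots,G_r$, $V(G)$ can be covered by the vertex sets of at most $2r-2$ connected components of the graphs $G_1,\dots,G_r$. (4) For every finite biclique $G$ and every antichain partition of $G$ into $r$ bi-equivalence graphs $G_1,\dots,G_r$, $V(G)$ can be covered by the vertex sets of at most $2r-2$ connected components of the graphs $G_1,\dots,G_r$.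
   Context: A biclique $[X,Y]$ is a complete bipartite graph with nonempty vertex classes $X$ and $Y$. Given an edge coloring, a monochromatic component is a connected component of the subgraph formed by the edges of any one given color. A bi-equivalence graph is a graph each of whose connected components is a biclique. A partition of a biclique $G=[X,Y]$ into bi-equivalence graphs $G_1,\dots,G_r$ means that every edge of $G$ belongs to exactly one $G_i$, each $G_i$ being a bi-equivalence graph. For a connected component $C$ of some $G_i$, the sets $X\cap V(C)$ and $Y\cap V(C)$ are called an $X$-block and a $Y$-block (in color $i$). The partition is spanning if every vertex of $G$ is incident with at least one edge of each $G_i$. An antichain partition is a spanning partition in which no $X$-block (of any color) is properly contained in another $X$-block (of any color), and no $Y$-block is properly contained in another $Y$-block. *)

(* Defs.v *)
From mathcomp Require Import all_boot.

Set Implicit Arguments.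
Unset Strict Implicit.
Unset Printing Implicit Defensive.

(* A finite simple graph whose vertex set [verts] is a subset of an ambient
   finite type, so that a graph and its subgraphs (which may have fewer
   vertices) live over the same type [V]. *)
Record graph (V : finType) := Graph {
  verts : {set V};
  adj : rel V;
  adj_sym : symmetric adj;
  adj_irrefl : irreflexive adj;
  adj_verts : forall u v, adj u v -> u \in verts
}.

Definition subgraph (V : finType) (H G : graph V) : Prop :=
  verts H \subset verts G /\ forall u v, adj H u v -> adj G u v.

Section Induced.
Variables (V : finType) (G : graph V) (A : {set V}).

Let ind_adj : rel V := fun u v => [&& u \in A, v \in A & adj G u v].

Lemma induced_sym : symmetric ind_adj.
Proof. by move=> u v; rewrite /ind_adj adj_sym andbCA. Qed.

Lemma induced_irrefl : irreflexive ind_adj.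
Proof. by move=> u; rewrite /ind_adj adj_irrefl !andbF. Qed.

Lemma induced_verts u v : ind_adj u v -> u \in verts G :&: A.
Proof. by case/and3P=> uA _ /adj_verts uG; rewrite inE uG. Qed.

Definition induced : graph V :=
  Graph induced_sym induced_irrefl induced_verts.
End Induced.

Definition components (V : finType) (G : graph V) : {set {set V}} :=
  [set [set v | connect (adj G) u v] | u in verts G].

Definition is_biclique (V : finType) (G : graph V) (X Y : {set V}) : Prop :=
  [/\ X != set0, Y != set0, [disjoint X & Y], verts G = X :|: Y
    & forall u v, adj G u v =
        ((u \in X) && (v \in Y)) || ((u \in Y) && (v \in X))].

(* An isolated vertex is a component that is not a biclique, so a
   bi-equivalence graph has none; the empty graph is a bi-equivalence graph. *)
Definition bi_equivalence (V : finType) (G : graph V) : Prop :=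
  forall C, C \in components G ->
    exists X Y : {set V}, is_biclique (induced G C) X Y.

(* The edge {u, v} of [G] has color [c [set u; v]]; the values of [c] at sets
   that are not edges are irrelevant.  [color_graph i] is the subgraph formed
   by the edges of color [i], so its vertices are the ends of those edges. *)
Section ColorGraph.
Variables (V : finType) (G : graph V) (r : nat) (c : {set V} -> 'I_r).
Variable i : 'I_r.

Let col_adj : rel V := fun u v => adj G u v && (c [set u; v] == i).

Lemma color_sym : symmetric col_adj.
Proof. by move=> u v; rewrite /col_adj adj_sym setUC. Qed.

Lemma color_irrefl : irreflexive col_adj.
Proof. by move=> u; rewrite /col_adj adj_irrefl. Qed.

Lemma color_verts u v : col_adj u v -> u \in [set w | [exists z, col_adj w z]].
Proof. by move=> uv; rewrite inE; apply/existsP; exists v. Qed.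

Definition color_graph : graph V :=
  Graph color_sym color_irrefl color_verts.
End ColorGraph.

Section Families.
Variables (V : finType) (r : nat) (G : graph V) (H : 'I_r -> graph V).

Definition all_components : {set {set V}} := \bigcup_i components (H i).

Definition covered_by_components (k : nat) : Prop :=
  exists S : {set {set V}},
    [/\ S \subset all_components, #|S| <= k & verts G \subset cover S].

Definition bi_equivalence_partition : Prop :=
  [/\ forall i, subgraph (H i) G,
      forall i, bi_equivalence (H i)
    & forall u v, adj G u v -> exists! i, adj (H i) u v].

Definition spanning : Prop :=
  forall i u, u \in verts G -> exists v, adj (H i) u v.

Definition blocks (X : {set V}) : {set {set V}} :=
  [set X :&: C | C in all_components].

Definition antichain_blocks (X : {set V}) : Prop :=
  forall B B', B \in blocks X -> B' \in blocks X -> ~~ (B \proper B').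

Definition spanning_partition : Prop := bi_equivalence_partition /\ spanning.

Definition antichain_partition (X Y : {set V}) : Prop :=
  [/\ spanning_partition, antichain_blocks X & antichain_blocks Y].
End Families.

(* Main.v *)
Require Import Defs.
From mathcomp Require Import all_boot.

Set Implicit Arguments.
Unset Strict Implicit.
Unset Printing Implicit Defensive.

(** For x in X and y in Y, the monochromatic components containing x cover Y
    and those containing y cover X; the component of the edge xy is counted
    twice, so at most 2r - 1 components are needed.  One more can be spared if
    x and y lie in a common component of two different colors, if some vertex
    misses a color, or if some block is properly contained in another one.
    Otherwise the color classes form an antichain partition. *)

(** * Covers by monochromatic components of two vertices *)

Section Covers.
Variables (V : finType) (G : graph V).

Lemma connect_adj_sym (K : graph V) : connect_sym (adj K).
Proof. exact/sym_connect_sym/adj_sym. Qed.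

Lemma connect_verts (K : graph V) u v :
  u \in verts K -> connect (adj K) u v -> v \in verts K.
Proof.
(* Reversing the path makes [v] its start, so [v] is either [u] itself or the first end of an
   edge. *)
move=> uK; rewrite connect_adj_sym => /connectP[[|w p] /=].
  by move=> _ <-.
by case/andP=> /adj_verts.
Qed.

Lemma adj_set2 (K : graph V) u v a b :
  a \in [set u; v] -> b \in [set u; v] -> adj K a b -> adj K u v.
Proof.
by rewrite !inE => /orP[] /eqP-> /orP[] /eqP->; rewrite ?adj_irrefl // adj_sym.
Qed.

Lemma biclique_sym X Y : is_biclique G X Y -> is_biclique G Y X.
Proof.
case=> X0 Y0 dXY GE adjE; split=> //; first by rewrite disjoint_sym.
  by rewrite GE setUC.
by move=> u v; rewrite adjE orbC.
Qed.

(** The cover takes the component of [x] in each color of [I] and that of [y] in each color of [J].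
    A vertex has no component in a color it misses, hence the conditions on [verts]. *)
Lemma covered_by_two_vertices r (H : 'I_r -> graph V) k x y (I J : {set 'I_r}) :
    #|I| + #|J| <= k ->
    {in verts G, forall v,
      (exists2 i, i \in I & x \in verts (H i) /\ connect (adj (H i)) x v) \/
      (exists2 j, j \in J & y \in verts (H j) /\ connect (adj (H j)) y v)} ->
  covered_by_components G H k.
Proof.
move=> IJk covG; pose K i u := [set v | connect (adj (H i)) u v].
exists ([set K i x | i in I & x \in verts (H i)]
        :|: [set K j y | j in J & y \in verts (H j)]).
split.
- apply/subsetP=> C; rewrite inE => /orP[] /imsetP[i];
    rewrite inE => /andP[_ iv] ->; apply/bigcupP; exists i => //;
    exact: imset_f.
- apply: leq_trans IJk; apply: leq_trans (leq_card_setU _ _) _.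
  by apply: leq_add; apply: leq_trans (leq_imset_card _ _) _;
    apply/subset_leq_card/subsetP=> i; rewrite inE => /andP[].
apply/subsetP=> v /covG[] [i iI [iv xv]]; apply/bigcupP.
  by exists (K i x); rewrite inE //; apply/orP; left; apply/imset_f; rewrite inE iI.
by exists (K i y); rewrite inE //; apply/orP; right; apply/imset_f; rewrite inE iI.
Qed.

End Covers.

(** * Sparing one more component in a colored biclique *)

Section ColoredBiclique.
Variables (V : finType) (G : graph V) (r : nat) (c : {set V} -> 'I_r).
Implicit Types X Y : {set V}.

Let H := color_graph G c.

Lemma color_vertsE i u : (u \in verts (H i)) = [exists v, adj (H i) u v].
Proof. by rewrite inE. Qed.

Lemma color_adj X Y x y : is_biclique G X Y -> x \in X -> y \in Y ->
  adj (H (c [set x; y])) x y.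
Proof. by case=> _ _ _ _ adjE xX yY; rewrite /= adjE xX yY eqxx. Qed.

Lemma color_connect X Y x y : is_biclique G X Y -> x \in X -> y \in Y ->
  x \in verts (H (c [set x; y])) /\ connect (adj (H (c [set x; y]))) x y.
Proof.
move=> bG xX yY; have xy := color_adj bG xX yY.
by split; [exact: adj_verts xy | exact: connect1].
Qed.

(** An edge from [x] to [v] already puts [v] in a component of [x], and likewise for [y]. Only
    vertices whose edge has an omitted color must be reached from the opposite end. *)
Lemma covered_by_edge_ends X Y x y (I J : {set 'I_r}) k :
    is_biclique G X Y -> x \in X -> y \in Y -> #|I| + #|J| <= k ->
    {in Y, forall v, c [set x; v] \notin I ->
      exists2 j, j \in J & y \in verts (H j) /\ connect (adj (H j)) y v} ->
    {in X, forall v, c [set v; y] \notin J ->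
      exists2 i, i \in I & x \in verts (H i) /\ connect (adj (H i)) x v} ->
  covered_by_components G H k.
Proof.
move=> bG xX yY IJk covY covX; apply: (covered_by_two_vertices (x := x) (y := y) IJk).
have [_ _ _ GE _] := bG; move=> v; rewrite GE inE => /orP[vX | vY].
  have [vJ|/(covX v vX) ?] := boolP (c [set v; y] \in J); last by left.
  right; exists (c [set v; y]) => //; rewrite setUC.
  exact: color_connect (biclique_sym bG) yY vX.
have [vI|/(covY v vY) ?] := boolP (c [set x; v] \in I); last by right.
by left; exists (c [set x; v]) => //; exact: color_connect bG xX vY.
Qed.

Lemma card_setTD1 (i : 'I_r) : #|[set: 'I_r] :\ i| = r.-1.
Proof. by have := cardsD1 i setT; rewrite cardsT card_ord inE => /(congr1 predn). Qed.

Lemma card_setTD2 (i j : 'I_r) : i != j -> #|[set: 'I_r] :\ i :\ j| = r.-2.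
Proof.
move=> ij; have := cardsD1 j (setT :\ i).
by rewrite card_setTD1 !inE eq_sym ij => /(congr1 predn).
Qed.

(** In colors [i] and [j] the component of [y] is also that of [x], so it is counted only once: r +
    (r - 2) components remain. *)
Lemma covered_if_two_common_colors X Y x y i j :
    2 <= r -> is_biclique G X Y -> x \in X -> y \in Y -> i != j ->
    connect (adj (H i)) x y -> connect (adj (H j)) x y ->
  covered_by_components G H (2 * r - 2).
Proof.
move=> r2 bG xX yY ij xyi xyj.
apply: (@covered_by_edge_ends _ _ _ _ setT (setT :\ i :\ j) _ bG xX yY).
- by rewrite cardsT card_ord card_setTD2 // -subn2 addnBA // addnn mul2n.
- by move=> v _; rewrite inE.
move=> v vX; rewrite !inE andbT negb_and !negbK => l_ij.
exists (c [set v; y]) => //; have [vl vy] := color_connect bG vX yY.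
have vx : connect (adj (H (c [set v; y]))) v x.
  by rewrite (connect_trans vy) // connect_adj_sym; case/orP: l_ij => /eqP->.
by split; [exact: connect_verts vx | rewrite connect_adj_sym].
Qed.

(** Here [x] has at most r - 1 components, and those of an arbitrary [y] include one shared through
    the edge [xy], leaving r - 1 others. *)
Lemma covered_if_missing_color X Y x i :
    2 <= r -> is_biclique G X Y -> x \in X -> x \notin verts (H i) ->
  covered_by_components G H (2 * r - 2).
Proof.
move=> r2 bG xX xi; have [_ /set0Pn[y yY] _ _ _] := bG.
have [xk xy] := color_connect bG xX yY.
apply: (@covered_by_edge_ends _ _ _ _ (setT :\ i) (setT :\ c [set x; y]) _ bG xX yY).
- by rewrite !card_setTD1 -subn1 addnn -mul2n mulnBr.
- move=> v vY; rewrite !inE andbT negbK => /eqP ci.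
  by have [] := color_connect bG xX vY; rewrite ci (negPf xi).
move=> v vX; rewrite !inE andbT negbK => /eqP ck.
(* The vertex [v] is reached from [x] through [y]; this color is not [i], since [x] misses [i]. *)
exists (c [set x; y]).
  by rewrite !inE andbT; apply: contraNneq xi => <-.
split=> //; apply: connect_trans xy _; rewrite connect_adj_sym.
by have [_] := color_connect bG vX yY; rewrite ck.
Qed.

(** Take [x] in [B'] outside [B], and [y] in [Y] in the component that cuts out [B]. That component
    may be dropped from those of [y]: its vertices in [X] lie in [B'], hence in a component of [x].
    The component of the edge [xy] is dropped as well. *)
Lemma covered_if_nested_blocks X Y B B' :
    2 <= r -> is_biclique G X Y ->
    B \in blocks H X -> B' \in blocks H X -> B \proper B' ->
  covered_by_components G H (2 * r - 2).
Proof.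
move=> r2 bG /imsetP[C /bigcupP[i _ /imsetP[u ui ->]] ->].
move=> /imsetP[C' /bigcupP[j _ /imsetP[u' uj ->]] ->].
case/properP=> /subsetP BB' [x]; rewrite !inE => /andP[xX u'x].
rewrite xX /= => Nux.
(* The component of [u] contains an edge, one end of which lies in [Y]. *)
have [y yY uy] : exists2 y, y \in Y & connect (adj (H i)) u y.
  move: ui; rewrite color_vertsE => /existsP[w uw].
  have [_ _ _ _ adjE] := bG.
  have /andP[] := uw; rewrite adjE => /orP[] /andP[uX wY] _.
    by exists w => //; exact: connect1.
  by exists u.
have [xk xy] := color_connect bG xX yY.
(* Otherwise the edge [xy] would put [x] in the component of [u], hence in [B]. So two distinct
   colors are dropped. *)
have ik : i != c [set x; y].
  apply: contraNneq Nux => ik; rewrite (connect_trans uy) //.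
  by rewrite connect_adj_sym ik.
apply: (@covered_by_edge_ends _ _ _ _ setT (setT :\ i :\ c [set x; y]) _ bG xX yY).
- by rewrite cardsT card_ord card_setTD2 // -subn2 addnBA // addnn mul2n.
- by move=> v _; rewrite inE.
move=> v vX; rewrite !inE andbT negb_and !negbK => l_ik.
have [vl vy] := color_connect bG vX yY.
case/orP: l_ik => /eqP lE; rewrite lE in vl vy.
  exists (c [set x; y]) => //; split=> //.
  by apply: connect_trans xy _; rewrite connect_adj_sym.
have uv : connect (adj (H i)) u v.
  by apply: connect_trans uy _; rewrite connect_adj_sym.
have := BB' v; rewrite !inE vX uv => /(_ isT) /= u'v.
exists j; first exact: in_setT.
split; first exact: connect_verts uj u'x.
by apply: (@connect_trans _ (adj (H j)) u') u'v; rewrite connect_adj_sym.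
Qed.

(** Two vertices on opposite sides of a component of color [i] are also connected in the color of
    their edge; uniqueness makes that color [i], so the component is complete bipartite. *)
Lemma color_bi_equivalence_partition X Y :
    is_biclique G X Y ->
    (forall x y i j, x \in X -> y \in Y ->
       connect (adj (H i)) x y -> connect (adj (H j)) x y -> i = j) ->
  bi_equivalence_partition G H.
Proof.
move=> bG uniq_color; have [X0 Y0 dXY GE adjE] := bG; split.
- move=> i; split; last by move=> u v /andP[].
  apply/subsetP=> u; rewrite color_vertsE => /existsP[v /andP[]].
  by move=> /adj_verts.
- move=> i C /imsetP[u ui CE].
  have CV v : v \in C -> v \in verts (H i).
    by rewrite CE inE; apply: connect_verts.
  have CC v w : v \in C -> w \in C -> connect (adj (H i)) v w.
    rewrite CE !inE => uv; apply: connect_trans.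
    by rewrite connect_adj_sym.
  have uC : u \in C by rewrite CE inE connect0.
  have [w uw] : exists w, adj (H i) u w by apply/existsP; rewrite -color_vertsE.
  have wC : w \in C by rewrite CE inE connect1.
  have XY_adj v z : v \in X -> z \in Y -> v \in C -> z \in C -> adj (H i) v z.
    move=> vX zY vC zC; have [_ vz] := color_connect bG vX zY.
    by rewrite (uniq_color _ _ _ _ vX zY (CC _ _ vC zC) vz) (color_adj bG).
  exists (X :&: C), (Y :&: C); split.
  + have /andP[] := uw; rewrite adjE => /orP[] /andP[uX wX] _; apply/set0Pn.
      by exists u; rewrite inE uX.
    by exists w; rewrite inE wX.
  + have /andP[] := uw; rewrite adjE => /orP[] /andP[uX wX] _; apply/set0Pn.
      by exists w; rewrite inE wX.
    by exists u; rewrite inE uX.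
  + by apply: disjointWl (subsetIl _ _) _; apply: disjointWr (subsetIl _ _) dXY.
  + rewrite -setIUl -GE; apply/setP=> v; rewrite in_setI.
    transitivity ((v \in verts (H i)) && (v \in C)); first exact: in_setI.
    have [vC|] := boolP (v \in C); rewrite ?andbF ?andbT //.
    rewrite (CV v vC); have := CV v vC; rewrite color_vertsE => /existsP[z].
    by case/andP=> /adj_verts->.
  move=> v z; rewrite !inE; apply/and3P/idP.
    case=> vC zC /andP[]; rewrite adjE vC zC.
    by case/orP=> /andP[-> ->]; rewrite ?orbT.
  case/orP=> /andP[/andP[vX vC] /andP[zY zC]]; split=> //.
    exact: XY_adj.
  by rewrite adj_sym; apply: XY_adj.
move=> u v uv; exists (c [set u; v]); split; first by rewrite /= uv eqxx.
by move=> i /andP[_ /eqP].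
Qed.

End ColoredBiclique.

(** * Passing between colorings and partitions *)

Lemma covered_if_antichain_covered (r : nat) (V : finType) (G : graph V)
    (X Y : {set V}) (c : {set V} -> 'I_r) :
    2 <= r -> is_biclique G X Y ->
    (antichain_partition G (color_graph G c) X Y ->
     covered_by_components G (color_graph G c) (2 * r - 2)) ->
  covered_by_components G (color_graph G c) (2 * r - 2).
Proof.
move=> r2 bG covAC; have bG' := biclique_sym bG.
have [_ _ _ GE _] := bG; set H := color_graph G c.
(* Each failure of the antichain partition is decidable on finite data and gives a cover directly;
   failures on the side [Y] use the exchanged biclique [bG']. *)
case: (boolP [exists x in X, exists y in Y, exists i, exists j,
  [&& i != j, connect (adj (H i)) x y & connect (adj (H j)) x y]]).
  case/exists_inP=> x xX /exists_inP[y yY] /existsP[i /existsP[j /and3P[ij xyi xyj]]].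
  exact: covered_if_two_common_colors r2 bG xX yY ij xyi xyj.
move=> Ncommon.
case: (boolP [exists x in verts G, exists i, x \notin verts (H i)]).
  case/exists_inP=> x; rewrite GE inE => /orP[] xXY /existsP[i xi].
    exact: covered_if_missing_color r2 bG xXY xi.
  exact: covered_if_missing_color r2 bG' xXY xi.
move=> Nmissing.
case: (boolP [exists B in blocks H X, exists B' in blocks H X, B \proper B']).
  case/exists_inP=> B BX /exists_inP[B' B'X BB'].
  exact: covered_if_nested_blocks r2 bG BX B'X BB'.
move=> NnestedX.
case: (boolP [exists B in blocks H Y, exists B' in blocks H Y, B \proper B']).
  case/exists_inP=> B BY /exists_inP[B' B'Y BB'].
  exact: covered_if_nested_blocks r2 bG' BY B'Y BB'.
move=> NnestedY; apply: covAC; split; first split.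
- apply: color_bi_equivalence_partition bG _ => x y i j xX yY xyi xyj.
  apply: contraNeq Ncommon => ij.
  apply/exists_inP; exists x => //; apply/exists_inP; exists y => //.
  by apply/existsP; exists i; apply/existsP; exists j; apply/and3P.
- move=> i u uG; apply/existsP; rewrite -color_vertsE.
  apply: contraNT Nmissing => ui; apply/exists_inP; exists u => //.
  by apply/existsP; exists i.
- move=> B B' BX B'X; apply: contraNN NnestedX => BB'.
  by apply/exists_inP; exists B => //; apply/exists_inP; exists B'.
move=> B B' BY B'Y; apply: contraNN NnestedY => BB'.
by apply/exists_inP; exists B => //; apply/exists_inP; exists B'.
Qed.

Lemma bi_equivalence_partition_coloring (r : nat) (V : finType) (G : graph V)
    (H : 'I_r -> graph V) :
    0 < r -> bi_equivalence_partition G H ->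
  exists c : {set V} -> 'I_r, forall i, adj (color_graph G c i) =2 adj (H i).
Proof.
move=> r0 [HG _ partH].
pose joins (e : {set V}) i := [exists u in e, exists v in e, adj (H i) u v].
have joinsE u v i : joins [set u; v] i = adj (H i) u v.
  apply/exists_inP/idP => [[a ae /exists_inP[b be]]|uv].
    exact: adj_set2.
  by exists u; rewrite ?set21 //; apply/exists_inP; exists v; rewrite ?set22.
(* The default color is taken only at sets containing no edge of any [H i]. *)
exists (fun e => odflt (Ordinal r0) [pick i | joins e i]) => i u v /=.
apply/andP/idP => [[/partH[j [uvj _]]]|uv].
  by case: pickP => [k|/(_ j)]; rewrite joinsE ?uvj // => uvk /eqP<-.
have [_ HGi] := HG i; split; first exact: HGi.
(* The picked color need not be [i] by construction; uniqueness identifies both with [j]. *)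
have [j [_ uniq_j]] := partH _ _ (HGi _ _ uv).
case: pickP => [k|/(_ i)]; rewrite joinsE ?uv // => uvk.
by rewrite /= -(uniq_j _ uvk) (uniq_j _ uv).
Qed.

Theorem mainTheorem5 (r : nat) (hr : 2 <= r) :
  [<-> forall (V : finType) (G : graph V) (X Y : {set V}),
         is_biclique G X Y ->
         forall c : {set V} -> 'I_r,
           covered_by_components G (color_graph G c) (2 * r - 2);
       forall (V : finType) (G : graph V) (X Y : {set V}),
         is_biclique G X Y ->
         forall H : 'I_r -> graph V,
           bi_equivalence_partition G H ->
           covered_by_components G H (2 * r - 2);
       forall (V : finType) (G : graph V) (X Y : {set V}),
         is_biclique G X Y ->
         forall H : 'I_r -> graph V,
           spanning_partition G H ->
           covered_by_components G H (2 * r - 2);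
       forall (V : finType) (G : graph V) (X Y : {set V}),
         is_biclique G X Y ->
         forall H : 'I_r -> graph V,
           antichain_partition G H X Y ->
           covered_by_components G H (2 * r - 2)].
Proof.
tfae.
- move=> cov V G X Y bG H partH.
  have [c cH] := bi_equivalence_partition_coloring (ltnW hr) partH.
  have [S [Scomp Scard Scov]] := cov V G X Y bG c; exists S; split=> //.
  (* A vertex of a color graph has an edge of that color, so it is a vertex of [H i], and equal
     adjacency gives it the same component there. *)
  apply: subset_trans Scomp _; apply/subsetP=> C /bigcupP[i _ /imsetP[u ui ->]].
  apply/bigcupP; exists i => //; apply/imsetP; exists u.
    by move: ui; rewrite color_vertsE => /existsP[v]; rewrite cH; exact: adj_verts.
  by apply/setP=> v; rewrite !inE; exact: eq_connect.
- by move=> cov V G X Y bG H [partH _]; apply: cov bG _ partH.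
- by move=> cov V G X Y bG H [spanH _ _]; apply: cov bG _ spanH.
move=> cov V G X Y bG c.
apply: (covered_if_antichain_covered hr bG); exact: cov.
Qed.
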